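(* Let $(M^n,g)$ be an oriented Riemannian manifold, let $G\subset\mathrm{SO}_n$ be a Lie subgroup with inclusion $i:G\to\mathrm{SO}_n$, and let $P\subset P_{\mathrm{SO}_n}M$ be a $G$-structure on $M$ which is connected as a topological space. Let $\phi_1,\phi_2:G\to\mathrm{Spin}_n$ be two different lifts of $G$, i.e. two distinct Lie group homomorphisms with $\pi\circ\phi_1=\pi\circ\phi_2=i$. Then the spin structures $P\times_{\phi_1}\mathrm{Spin}_n$ and $P\times_{\phi_2}\mathrm{Spin}_n$ on $M$ are not equivalent as spin structures.
   Context: $P_{\mathrm{SO}_n}M$ is the bundle of oriented orthonormal frames of $M$ and $\pi:\mathrm{Spin}_n\to\mathrm{SO}_n$ is the canonical double covering. A $G$-structure is a reduction of the structure group of $P_{\mathrm{SO}_n}M$ to $G$, i.e. a $G$-principal subbundle $P$; there is a canonical isomorphism $P\times_i\mathrm{SO}_n\simeq P_{\mathrm{SO}_n}M$. For a homomorphism $\phi:G\to\mathrm{Spin}_n$ with $\pi\circ\phi=i$, the enlargement $P\times_\phi\mathrm{Spin}_n$ (the quotient of $P\times\mathrm{Spin}_n$ by $(ug,a)\sim(u,\phi(g)a)$), together with the projection $[u,a]\mapsto[u,\pi(a)]$ onto $P\times_i\mathrm{SO}_n\simeq P_{\mathrm{SO}_n}M$, is a spin structure on $M$. A spin structure is a $\mathrm{Spin}_n$-principal bundle over $M$ with a $\pi$-equivariant 2-fold covering onto $P_{\mathrm{SO}_n}M$ over the identity of $M$. Two spin structures $Q,Q'$ are equivalent if there is an isomorphism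 of $\mathrm{Spin}_n$-principal bundles $F:Q\to Q'$ commuting with the projections to $P_{\mathrm{SO}_n}M$. *)

(* Defs.v *)
From HB Require Import structures.
From mathcomp Require Import all_boot all_order all_algebra.
From mathcomp Require Import all_classical all_reals.
From mathcomp Require Import topology normedtype derive.
From mathcomp Require Import ring.

Set Implicit Arguments.
Unset Strict Implicit.
Unset Printing Implicit Defensive.

Import Order.TTheory GRing.Theory Num.Theory.
Import numFieldNormedType.Exports.

Local Open Scope classical_set_scope.
Local Open Scope ring_scope.

(* The Clifford algebra of R^n with e_i^2 = -1. The basis vector e_A, for
   A = {a_1 < ... < a_r}, is e_(a_1) ... e_(a_r); the coordinate of x on e_A is
   x 0 (enum_rank A). *)
Definition cliff (R : realType) (n : nat) := 'rV[R]_#|{set 'I_n}|.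

Section Clifford.
Context {R : realType} {n : nat}.
Implicit Types (A B C : {set 'I_n}) (x y z : cliff R n).

Definition ccoef x A : R := x ord0 (enum_rank A).

Definition cbuild (f : {set 'I_n} -> R) : cliff R n :=
  \row_i f (enum_val i).

Definition symdiff A B := (A :\: B) :|: (B :\: A).

(* e_A * e_B = csign A B *: e_(symdiff A B): each e_b, b \in B, is moved
   leftwards past the e_a with a > b, and e_b * e_b = -1. *)
Definition csign A B : R :=
  \prod_(a in A) \prod_(b in B) (if (b <= a)%N then -1 else 1).

Definition cmul x y : cliff R n := cbuild (fun C =>
  \sum_A csign A (symdiff A C) * ccoef x A * ccoef y (symdiff A C)).

Definition cbase A : cliff R n := cbuild (fun B => (B == A)%:R).

(* The anti-automorphism such that e_i |-> - e_i *)
Definition cconj x : cliff R n := cbuild (fun A => csign A A * ccoef x A).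

Definition ceven x := [forall A : {set 'I_n}, odd #|A| ==> (ccoef x A == 0)].

Lemma cbuildE f A : ccoef (cbuild f) A = f A.
Proof. by rewrite /ccoef mxE enum_rankK. Qed.

Lemma cliffP x y : (forall A, ccoef x A = ccoef y A) -> x = y.
Proof. by move=> h; apply/rowP => i; have := h (enum_val i); rewrite /ccoef enum_valK. Qed.

Lemma ccoefD x y A : ccoef (x + y) A = ccoef x A + ccoef y A.
Proof. by rewrite /ccoef mxE. Qed.

Lemma ccoefZ a x A : ccoef (a *: x) A = a * ccoef x A.
Proof. by rewrite /ccoef mxE. Qed.

Lemma ccoef_sum I (r : seq I) (P : pred I) (F : I -> cliff R n) A :
  ccoef (\sum_(i <- r | P i) F i) A = \sum_(i <- r | P i) ccoef (F i) A.
Proof. by rewrite /ccoef summxE. Qed.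

Lemma symdiffE A B i : (i \in symdiff A B) = (i \in A) (+) (i \in B).
Proof. by rewrite !inE; do 2 case: (_ \in _). Qed.

Lemma symdiffA : associative symdiff.
Proof. by move=> A B C; apply/setP=> i; rewrite !symdiffE addbA. Qed.

Lemma symdiffK A : involutive (symdiff A).
Proof. by move=> B; apply/setP=> i; rewrite !symdiffE addbA addbb. Qed.

Lemma symdiffC : commutative symdiff.
Proof. by move=> A B; apply/setP=> i; rewrite !symdiffE addbC. Qed.

Lemma symdiff0 A : symdiff finset.set0 A = A.
Proof. by apply/setP=> i; rewrite symdiffE inE. Qed.

Lemma symdiffv A : symdiff A A = finset.set0.
Proof. by apply/setP=> i; rewrite symdiffE inE addbb. Qed.

Lemma prod_symdiff (f : 'I_n -> R) A B : (forall i, f i ^+ 2 = 1) ->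
  \prod_(i in symdiff A B) f i = (\prod_(i in A) f i) * (\prod_(i in B) f i).
Proof.
move=> f2; rewrite ![\prod_(i in _) _]big_mkcond /= -big_split /=.
apply: eq_bigr => i _; rewrite symdiffE.
by case: (i \in A); case: (i \in B); rewrite ?mulr1 ?mul1r // -expr2 f2.
Qed.

Lemma sqr_sgn_if (b : bool) : (if b then -1 else 1 : R) ^+ 2 = 1.
Proof. by case: b; rewrite ?sqrrN expr1n. Qed.

Lemma csignDl A B C : csign (symdiff A B) C = csign A C * csign B C.
Proof.
apply: prod_symdiff => i; rewrite -prodrXl.
by apply: big1 => j _; exact: sqr_sgn_if.
Qed.

Lemma csignDr A B C : csign A (symdiff B C) = csign A B * csign A C.
Proof.
rewrite /csign -big_split /=; apply: eq_bigr => i _.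
by apply: prod_symdiff => j; exact: sqr_sgn_if.
Qed.

Lemma csign0l A : csign finset.set0 A = 1.
Proof. by rewrite /csign big_set0. Qed.

Lemma csign0r A : csign A finset.set0 = 1.
Proof. by rewrite /csign big1 // => i _; rewrite big_set0. Qed.

Lemma csign2 A B : csign A B * csign A B = 1.
Proof. by rewrite -csignDl symdiffv csign0l. Qed.

Lemma reindex_symdiff A (F : {set 'I_n} -> R) :
  \sum_B F B = \sum_B F (symdiff A B).
Proof. by rewrite (reindex_inj (inv_inj (symdiffK A))). Qed.

Lemma cmulA : associative cmul.
Proof.
move=> x y z; apply: cliffP => D; rewrite !cbuildE.
transitivity (\sum_A \sum_B csign (symdiff A B) (symdiff (symdiff A B) D) *
    (csign A B * ccoef x A * ccoef y B) * ccoef z (symdiff (symdiff A B) D)).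
  apply: eq_bigr => A _; rewrite cbuildE mulr_sumr; apply: eq_bigr => B _.
  rewrite symdiffA (symdiffC B A) !csignDl !csignDr.
  have := csign2 A B; move: (csign A B) => u u2.
  move: (ccoef x A) (ccoef y B) (ccoef z _) => a b c.
  move: (csign A A) (csign A D) (csign B A) (csign B B) (csign B D) => p q r s t.
  rewrite -[LHS]mul1r -u2; ring.
under [RHS]eq_bigr => C _ do rewrite cbuildE mulr_sumr mulr_suml.
rewrite [RHS]exchange_big /=; apply: eq_bigr => A _.
by rewrite [RHS](reindex_symdiff A); apply: eq_bigr => B _; rewrite symdiffK.
Qed.

Lemma cmul1x : left_id (cbase finset.set0) cmul.
Proof.
move=> x; apply: cliffP => C; rewrite !cbuildE.
rewrite (bigD1 finset.set0) //= big1 => [|A A0]; last first.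
  by rewrite cbuildE (negPf A0) mulr0 mul0r.
by rewrite cbuildE eqxx symdiff0 csign0l !mul1r addr0.
Qed.

Lemma cmulx1 : right_id (cbase finset.set0) cmul.
Proof.
move=> x; apply: cliffP => C; rewrite !cbuildE.
rewrite (bigD1 C) //= big1 => [|A AC]; last first.
  rewrite [ccoef (cbase _) _]cbuildE; case: eqP => [e|_]; last by rewrite mulr0.
  move: (symdiffK A C); rewrite e symdiffC symdiff0 => e'.
  by rewrite e' eqxx in AC.
by rewrite symdiffv cbuildE eqxx csign0r !mul1r mulr1 addr0.
Qed.

Lemma cmulDl : left_distributive cmul +%R.
Proof.
move=> x y z; apply: cliffP => C; rewrite ccoefD !cbuildE -big_split /=.
by apply: eq_bigr => A _; rewrite ccoefD mulrDr mulrDl.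
Qed.

Lemma cmulDr : right_distributive cmul +%R.
Proof.
move=> x y z; apply: cliffP => C; rewrite ccoefD !cbuildE -big_split /=.
by apply: eq_bigr => A _; rewrite ccoefD mulrDr.
Qed.

Lemma cmulZl (a : R) x y : cmul (a *: x) y = a *: cmul x y.
Proof.
apply: cliffP => C; rewrite ccoefZ !cbuildE mulr_sumr.
by apply: eq_bigr => A _; rewrite ccoefZ; ring.
Qed.

Lemma cmulZr (a : R) x y : cmul x (a *: y) = a *: cmul x y.
Proof.
apply: cliffP => C; rewrite ccoefZ !cbuildE mulr_sumr.
by apply: eq_bigr => A _; rewrite ccoefZ; ring.
Qed.

Lemma cmul0x x : cmul 0 x = 0.
Proof. by rewrite -(scale0r (0 : cliff R n)) cmulZl !scale0r. Qed.

Lemma cmulx0 x : cmul x 0 = 0.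
Proof. by rewrite -(scale0r (0 : cliff R n)) cmulZr !scale0r. Qed.

Lemma cmul_suml I (r : seq I) (P : pred I) (F : I -> cliff R n) x :
  cmul (\sum_(i <- r | P i) F i) x = \sum_(i <- r | P i) cmul (F i) x.
Proof.
exact: (big_morph (cmul^~ x) (fun y z => cmulDl y z x) (cmul0x x)).
Qed.

Lemma cmul_sumr I (r : seq I) (P : pred I) (F : I -> cliff R n) x :
  cmul x (\sum_(i <- r | P i) F i) = \sum_(i <- r | P i) cmul x (F i).
Proof. exact: (big_morph (cmul x) (cmulDr x) (cmulx0 x)). Qed.

Lemma cmul_base A B : cmul (cbase A) (cbase B) = csign A B *: cbase (symdiff A B).
Proof.
apply: cliffP => C; rewrite ccoefZ !cbuildE.
rewrite (bigD1 A) //= big1 => [|A' nA]; last first.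
  by rewrite cbuildE (negPf nA) mulr0 mul0r.
rewrite !cbuildE eqxx mulr1 addr0.
have -> : (symdiff A C == B) = (C == symdiff A B).
  by apply/eqP/eqP => [<-|->]; rewrite symdiffK.
by case: eqP => [->|]; rewrite ?mulr0 // symdiffK.
Qed.

Lemma cconjM x y : cconj (cmul x y) = cmul (cconj y) (cconj x).
Proof.
apply: cliffP => C; rewrite !cbuildE mulr_sumr (reindex_symdiff C).
apply: eq_bigr => A _; rewrite !cbuildE (symdiffC _ C) symdiffK (symdiffC A C).
rewrite (symdiffC C) -[in csign C C](symdiffK A C) !csignDl !csignDr.
have h1 := csign2 A C; have h2 := csign2 A A; have h3 := csign2 C C; have h4 := csign2 C A.
move: (ccoef x _) (ccoef y _) => a b.
move: (csign A C) (csign A A) (csign C C) (csign C A) h1 h2 h3 h4 => p q r s h1 h2 h3 h4.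
ring: h1 h2 h3 h4.
Qed.

Lemma cconjK : involutive cconj.
Proof. by move=> x; apply: cliffP => A; rewrite !cbuildE mulrA csign2 mul1r. Qed.

Lemma cconjD x y : cconj (x + y) = cconj x + cconj y.
Proof. by apply: cliffP => A; rewrite ccoefD !cbuildE ccoefD mulrDr. Qed.

Lemma cconj1 : cconj (cbase finset.set0) = cbase finset.set0.
Proof.
apply: cliffP => A; rewrite !cbuildE.
by case: (eqVneq A finset.set0) => [->|_]; rewrite ?mulr0 // csign0l mul1r.
Qed.

Lemma odd_symdiff A B : odd #|symdiff A B| = odd #|A| (+) odd #|B|.
Proof.
rewrite /symdiff finset.cardsU.
have -> : (A :\: B) :&: (B :\: A) = finset.set0.
  by apply/setP => i; rewrite !inE; do 2 case: (_ \in _).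
rewrite cards0 subn0 oddD -(cardsID B A) -(cardsID A B) !oddD finset.setIC.
by case: (odd _); case: (odd _); case: (odd _).
Qed.

Lemma ceven_mul x y : ceven x -> ceven y -> ceven (cmul x y).
Proof.
move=> /forallP ex /forallP ey; apply/forallP => C; apply/implyP => oC.
apply/eqP; rewrite cbuildE big1 // => A _.
have := ex A; have := ey (symdiff A C); rewrite odd_symdiff oC addbT.
by case: (odd #|A|) => /= /eqP h1 /eqP h2; rewrite ?h1 ?h2 ?mulr0 ?mul0r.
Qed.

Lemma ceven1 : ceven (cbase finset.set0).
Proof.
apply/forallP => A; apply/implyP; rewrite cbuildE.
by case: (eqVneq A finset.set0) => [->|_]; rewrite ?eqxx ?implybT // cards0.
Qed.

Lemma ceven_conj x : ceven x -> ceven (cconj x).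
Proof.
move=> /forallP ex; apply/forallP => A; apply/implyP => oA; rewrite cbuildE.
by rewrite (eqP (implyP (ex A) oA)) mulr0.
Qed.

End Clifford.

Section SO.
Context (R : realType) (n : nat).

Definition special_orthogonal (A : 'M[R]_n) :=
  (A *m A^T == 1%:M) && (\det A == 1).

Record SO := MkSO { SO_mx :> 'M[R]_n; SO_mxP : special_orthogonal SO_mx }.

HB.instance Definition _ := [isSub for SO_mx].
HB.instance Definition _ := [Choice of SO by <:].

Lemma so1 : special_orthogonal 1%:M.
Proof. by rewrite /special_orthogonal trmx1 mulmx1 det1 !eqxx. Qed.

Lemma soM (A B : 'M[R]_n) : special_orthogonal A -> special_orthogonal B ->
  special_orthogonal (A *m B).
Proof.
move=> /andP[/eqP A1 /eqP A2] /andP[/eqP B1 /eqP B2]; apply/andP; split.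
  by rewrite trmx_mul mulmxA -(mulmxA A) B1 mulmx1 A1.
by rewrite det_mulmx A2 B2 mulr1.
Qed.

Lemma soV (A : 'M[R]_n) : special_orthogonal A -> special_orthogonal A^T.
Proof.
move=> /andP[/eqP A1 /eqP A2]; rewrite /special_orthogonal det_tr A2 eqxx andbT.
by rewrite trmxK; apply/eqP; exact: mulmx1C.
Qed.

Definition SO_one := MkSO so1.
Definition SO_mul (A B : SO) := MkSO (soM (SO_mxP A) (SO_mxP B)).
Definition SO_inv (A : SO) := MkSO (soV (SO_mxP A)).

Fact SO_mulA : associative SO_mul.
Proof. by move=> A B C; apply/val_inj/mulmxA. Qed.
Fact SO_mul1 : left_id SO_one SO_mul.
Proof. by move=> A; apply/val_inj/mul1mx. Qed.
Fact SO_mulr1 : right_id SO_one SO_mul.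
Proof. by move=> A; apply/val_inj/mulmx1. Qed.
Fact SO_mulV : right_inverse SO_one SO_inv SO_mul.
Proof. by move=> A; apply/val_inj; have /andP[/eqP] := SO_mxP A. Qed.
Fact SO_mulVl : left_inverse SO_one SO_inv SO_mul.
Proof. by move=> A; apply/val_inj/mulmx1C; have /andP[/eqP] := SO_mxP A. Qed.

HB.instance Definition _ := isGroup.Build SO
  SO_mulA SO_mul1 SO_mulr1 SO_mulVl SO_mulV.

End SO.

Section Spin.
Context (R : realType) (n : nat).
Implicit Types x y : cliff R n.

Definition cvec (i : 'I_n) : cliff R n := cbase [set i]%SET.

Lemma cvec_rel i j : cmul (cvec i) (cvec j) + cmul (cvec j) (cvec i) =
  (- (i == j)%:R *+ 2) *: cbase finset.set0.
Proof.
rewrite !cmul_base (symdiffC [set j]%SET) -scalerDl /csign !big_set1.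
have [->|ij] := eqVneq i j; first by rewrite leqnn symdiffv mulr2n.
suff -> : (if (j <= i)%N then -1 else 1) + (if (i <= j)%N then -1 else 1) = 0 :> R.
  by rewrite oppr0 mul0rn !scale0r.
have : (i != j :> nat) by [].
by case: ltngtP => // _ _; rewrite ?subrr ?addNr.
Qed.

(* Column j holds the coordinates in R^n of x e_j x^*. *)
Definition Ad_mx x : 'M[R]_n :=
  \matrix_(i, j) ccoef (cmul (cmul x (cvec j)) (cconj x)) [set i]%SET.

(* The even x with x^* = x^-1 such that v |-> x v x^-1 restricts to an element
   of SO(R^n). *)
Definition spin_pred x := [&& ceven x,
  cmul x (cconj x) == cbase finset.set0, cmul (cconj x) x == cbase finset.set0,
  [forall j, cmul (cmul x (cvec j)) (cconj x) == \sum_i Ad_mx x i j *: cvec i]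
  & special_orthogonal (Ad_mx x)].

Record Spin := MkSpin { spin_cliff :> cliff R n; spin_cliffP : spin_pred spin_cliff }.

HB.instance Definition _ := [isSub for spin_cliff].
HB.instance Definition _ := [Choice of Spin by <:].

Lemma ccoef_cvec (f : 'I_n -> R) i :
  ccoef (\sum_k f k *: cvec k) [set i]%SET = f i.
Proof.
rewrite ccoef_sum (bigD1 i) //= big1 => [|k ki].
  by rewrite ccoefZ cbuildE eqxx mulr1 addr0.
by rewrite ccoefZ cbuildE (inj_eq set1_inj) eq_sym (negPf ki) mulr0.
Qed.

Lemma Ad_mx_unique x (A : 'M[R]_n) :
  (forall j, cmul (cmul x (cvec j)) (cconj x) = \sum_i A i j *: cvec i) ->
  Ad_mx x = A.
Proof.
by move=> h; apply/matrixP => i j; rewrite mxE h (ccoef_cvec (A^~ j)).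
Qed.

Lemma spinI x (A : 'M[R]_n) : ceven x ->
  cmul x (cconj x) = cbase finset.set0 -> cmul (cconj x) x = cbase finset.set0 ->
  (forall j, cmul (cmul x (cvec j)) (cconj x) = \sum_i A i j *: cvec i) ->
  special_orthogonal A -> spin_pred x.
Proof.
move=> ex xx' x'x h sA; rewrite /spin_pred ex xx' x'x !eqxx /= (Ad_mx_unique h) sA.
by rewrite andbT; apply/forallP => j; rewrite h.
Qed.

Lemma spinE x : spin_pred x -> [/\ ceven x,
  cmul x (cconj x) = cbase finset.set0, cmul (cconj x) x = cbase finset.set0,
  forall j, cmul (cmul x (cvec j)) (cconj x) = \sum_i Ad_mx x i j *: cvec i
  & special_orthogonal (Ad_mx x)].
Proof.
by case/and5P => ? /eqP ? /eqP ? /forallP h ?; split => // j; apply/eqP.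
Qed.

Lemma Ad_mulE x y : spin_pred x -> spin_pred y -> forall j,
  cmul (cmul (cmul x y) (cvec j)) (cconj (cmul x y)) =
  \sum_i (Ad_mx x *m Ad_mx y) i j *: cvec i.
Proof.
move=> /spinE[_ _ _ hx _] /spinE[_ _ _ hy _] j.
rewrite cconjM -!cmulA (cmulA (cvec j)) (cmulA y) (cmulA y) hy.
rewrite cmulA cmul_sumr cmul_suml.
under eq_bigr => k _ do rewrite cmulZr cmulZl hx scaler_sumr.
rewrite exchange_big /=; apply: eq_bigr => i _.
rewrite mxE scaler_suml; apply: eq_bigr => k _.
by rewrite scalerA mulrC.
Qed.

Lemma spin1 : spin_pred (cbase finset.set0).
Proof.
apply: (@spinI _ 1%:M); rewrite ?ceven1 ?cconj1 ?cmul1x ?so1 // => j.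
rewrite cmul1x cmulx1 (bigD1 j) //= big1 => [|i ij].
  by rewrite mxE eqxx scale1r addr0.
by rewrite mxE (negPf ij) scale0r.
Qed.

Lemma spinM x y : spin_pred x -> spin_pred y -> spin_pred (cmul x y).
Proof.
move=> sx sy; have := Ad_mulE sx sy.
case/spinE: sx => ex xx' x'x _ sx; case/spinE: sy => ey yy' y'y _ sy h.
apply: (spinI _ _ _ h (soM sx sy)); first exact: ceven_mul.
  by rewrite cconjM cmulA -(cmulA x) yy' cmulx1 xx'.
by rewrite cconjM cmulA -(cmulA _ (cconj x)) x'x cmulx1 y'y.
Qed.

Lemma spinV x : spin_pred x -> spin_pred (cconj x).
Proof.
move=> /spinE[ex xx' x'x hx sx].
apply: (spinI _ _ _ _ (soV sx)); rewrite ?cconjK ?ceven_conj // => j.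
have -> : cvec j = \sum_i (\sum_k Ad_mx x j k * Ad_mx x i k) *: cvec i.
  have e i : \sum_k Ad_mx x j k * Ad_mx x i k = (j == i)%:R.
    case/andP: sx => /eqP /matrixP /(_ j i); rewrite !mxE => <- _.
    by apply: eq_bigr => k _; congr (_ * _); rewrite [RHS]mxE.
  under eq_bigr => i _ do rewrite e.
  rewrite (bigD1 j) //= eqxx scale1r big1 ?addr0 // => i ij.
  by rewrite eq_sym (negPf ij) scale0r.
under eq_bigr => i _ do rewrite scaler_suml.
rewrite exchange_big /=.
under eq_bigr => k _ do (under eq_bigr => i _ do rewrite -scalerA; rewrite -scaler_sumr -hx).
rewrite cmul_sumr cmul_suml; apply: eq_bigr => k _.
rewrite cmulZr cmulZl !mxE; congr (_ *: _).
by rewrite -!cmulA x'x cmulx1 cmulA x'x cmul1x.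
Qed.

Definition spin_one := MkSpin spin1.
Definition spin_mul (x y : Spin) := MkSpin (spinM (spin_cliffP x) (spin_cliffP y)).
Definition spin_inv (x : Spin) := MkSpin (spinV (spin_cliffP x)).

Fact spin_mulA : associative spin_mul.
Proof. by move=> A B C; apply/val_inj/cmulA. Qed.
Fact spin_mul1 : left_id spin_one spin_mul.
Proof. by move=> A; apply/val_inj/cmul1x. Qed.
Fact spin_mulr1 : right_id spin_one spin_mul.
Proof. by move=> A; apply/val_inj/cmulx1. Qed.
Fact spin_mulV : right_inverse spin_one spin_inv spin_mul.
Proof. by move=> A; apply/val_inj; case/spinE: (spin_cliffP A). Qed.
Fact spin_mulVl : left_inverse spin_one spin_inv spin_mul.
Proof. by move=> A; apply/val_inj; case/spinE: (spin_cliffP A). Qed.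

HB.instance Definition _ := isGroup.Build Spin
  spin_mulA spin_mul1 spin_mulr1 spin_mulVl spin_mulV.

HB.instance Definition _ := Topological.copy Spin (initial_topology spin_cliff).

Lemma Ad_mx_SO (x : Spin) : special_orthogonal (Ad_mx x).
Proof. by case/spinE: (spin_cliffP x). Qed.

Definition spin_cover (x : Spin) : SO R n := MkSO (Ad_mx_SO x).

Lemma spin_coverM (x y : Spin) :
  spin_cover (x * y)%g = (spin_cover x * spin_cover y)%g.
Proof.
by apply/val_inj/Ad_mx_unique/Ad_mulE; exact: spin_cliffP.
Qed.

End Spin.

(* C^r on the open set U, for V of finite dimension *)
Fixpoint Ck (R : realType) (V W : normedModType R) (r : nat) (U : set V)
    (f : V -> W) : Prop :=
  if r is r'.+1 then
    (forall x, U x -> differentiable f x) /\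
    (forall v, Ck r' U (fun x => 'D_v f x))
  else forall x, U x -> {for x, continuous f}.

Definition smooth_on (R : realType) (V W : normedModType R) (U : set V)
  (f : V -> W) := forall r, Ck r U f.

(* chart_inv is only meaningful on the image of chart_dom. *)
Record chart (R : realType) (k : nat) (T : topologicalType) := Chart {
  chart_dom : set T;
  chart_map :> T -> 'rV[R]_k;
  chart_inv : 'rV[R]_k -> T;
  chart_dom_open : open chart_dom;
  chart_im_open : open (chart_map @` chart_dom);
  chart_mapK : forall x, chart_dom x -> chart_inv (chart_map x) = x;
  chart_map_cont : forall x, chart_dom x -> {for x, continuous chart_map};
  chart_inv_cont : forall x, chart_dom x ->
    {for chart_map x, continuous chart_inv} }.

HB.mixin Record isManifold (R : realType) (k : nat) T of Topological T := {
  atlas : set (chart R k T);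
  atlas_cover : forall x : T, exists2 c, atlas c & chart_dom c x;
  atlas_smooth : forall c d, atlas c -> atlas d ->
    smooth_on (c @` (chart_dom c `&` chart_dom d)) (d \o chart_inv c);
  manifold_hausdorff : hausdorff_space T;
  manifold_second_countable : @second_countable T }.

#[short(type="manifoldType")]
HB.structure Definition Manifold (R : realType) (k : nat) :=
  { T of isManifold R k T & Topological T }.

Section SmoothMaps.
Context {R : realType}.

Definition smooth_fun_on k (X : manifoldType R k) (V : normedModType R)
    (U : set X) (f : X -> V) :=
  forall c, atlas c -> smooth_on (c @` (chart_dom c `&` U)) (f \o chart_inv c).

Definition smooth_map_on k l (X : manifoldType R k) (Y : manifoldType R l)
    (U : set X) (f : X -> Y) :=
  (forall x, U x -> {for x, continuous f}) /\
  forall c d, atlas c -> atlas d ->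
    smooth_on (c @` (chart_dom c `&` U `&` f @^-1` chart_dom d))
              (d \o f \o chart_inv c).

(* Smoothness of X x Y -> Z for the product manifold X x Y *)
Definition smooth_map2 k l m (X : manifoldType R k) (Y : manifoldType R l)
    (Z : manifoldType R m) (f : X -> Y -> Z) :=
  continuous (fun p : X * Y => f p.1 p.2) /\
  forall c d e, atlas c -> atlas d -> atlas e ->
    smooth_on
      ((fun p : X * Y => (c p.1, d p.2)) @`
        [set p | [/\ chart_dom c p.1, chart_dom d p.2 & chart_dom e (f p.1 p.2)]])
      (fun z => e (f (chart_inv c z.1) (chart_inv d z.2))).

End SmoothMaps.

HB.mixin Record isLieGroup (R : realType) (k : nat) G
    of Manifold R k G & Group G := {
  lie_mul_smooth : smooth_map2 (fun x y : G => (x * y)%g : G);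
  lie_inv_smooth : smooth_map_on [set: G] (fun x : G => (x^-1)%g : G) }.

#[short(type="lieGroupType")]
HB.structure Definition LieGroup (R : realType) (k : nat) :=
  { G of isLieGroup R k G & Manifold R k G & Group G }.

(* Immersed, not necessarily closed; SO_n is a submanifold of the space of
   matrices, so smoothness is tested there. *)
Record lie_subgroup (R : realType) (k n : nat) (G : lieGroupType R k) :=
  LieSubgroup {
  lie_incl :> G -> SO R n;
  lie_incl_inj : injective lie_incl;
  lie_inclM : forall a b, lie_incl (a * b)%g = (lie_incl a * lie_incl b)%g;
  lie_incl_smooth : smooth_fun_on [set: G] (@SO_mx R n \o lie_incl);
  lie_incl_immersion : forall c x, atlas c -> chart_dom c x ->
    injective ('d (@SO_mx R n \o lie_incl \o chart_inv c) (c x)) }.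

Record spin_lift (R : realType) (k n : nat) (G : lieGroupType R k)
  (i : lie_subgroup n G) := SpinLift {
  lift_fun :> G -> Spin R n;
  liftM : forall a b, lift_fun (a * b)%g = (lift_fun a * lift_fun b)%g;
  lift_smooth : smooth_fun_on [set: G]
    ((@spin_cliff R n : _ -> 'rV[R]_#|{set 'I_n}|) \o lift_fun);
  lift_cover : forall a, spin_cover (lift_fun a) = i a }.

Section Frames.
Context {R : realType} {n : nat} {M : manifoldType R n}.

Definition chart_at (p : M) : chart R n M := s2val (cid2 (atlas_cover p)).

(* T_pM is represented by 'rV[R]_n through the chart chart_at p. *)

(* v *m tangent_change c d p is the expression in d of the tangent vector at p
   with expression v in c. *)
Definition tangent_change (c d : chart R n M) (p : M) : 'M[R]_n :=
  jacobian (d \o chart_inv c) (c p).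

(* The rows are the vectors of T_pM tangent to the coordinate lines of c. *)
Definition coord_frame (c : chart R n M) (p : M) : 'M[R]_n :=
  tangent_change c (chart_at p) p.

End Frames.

Record riemannian_metric (R : realType) (n : nat) (M : manifoldType R n) :=
  RiemannianMetric {
  metric_mx :> M -> 'M[R]_n;
  metric_sym : forall p, (metric_mx p)^T = metric_mx p;
  metric_pos : forall p (v : 'rV[R]_n), v != 0 ->
    0 < (v *m metric_mx p *m v^T) ord0 ord0;
  metric_smooth : forall c, atlas c -> smooth_fun_on (chart_dom c)
    (fun p => coord_frame c p *m metric_mx p *m (coord_frame c p)^T) }.

(* A frame with matrix B at p is positive iff \det B has the sign
   (-1) ^+ orient p. *)
Record orientation (R : realType) (n : nat) (M : manifoldType R n) :=
  Orientation {
  orient :> M -> bool;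
  orient_cont : forall c p, atlas c -> chart_dom c p ->
    \forall q \near p, (0 < (-1) ^+ orient q * \det (coord_frame c q)) =
                       (0 < (-1) ^+ orient p * \det (coord_frame c p)) }.

Section FrameBundle.
Context {R : realType} {n : nat} {M : manifoldType R n}.
Variables (g : riemannian_metric M) (o : orientation M).

Definition oriented_orthonormal (p : M) (B : 'M[R]_n) :=
  (B *m g p *m B^T == 1%:M) && (0 < (-1) ^+ o p * \det B).

(* The rows of frame_mx are the vectors of the frame. *)
Record SO_frame := SOFrame {
  frame_pt : M;
  frame_mx : 'M[R]_n;
  frame_mxP : oriented_orthonormal frame_pt frame_mx }.

Lemma SO_frame_eq (f1 f2 : SO_frame) :
  frame_pt f1 = frame_pt f2 -> frame_mx f1 = frame_mx f2 -> f1 = f2.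
Proof.
case: f1 f2 => [p B h] [q C h'] /= e1 e2; move: h'; rewrite -e1 -e2 => h'.
by rewrite (bool_irrelevance h h').
Qed.

Lemma frame_act_subproof (f : SO_frame) (A : SO R n) :
  oriented_orthonormal (frame_pt f) (A^T *m frame_mx f).
Proof.
case: f => p B /= /andP[/eqP BB dB]; have /andP[/eqP AA /eqP dA] := SO_mxP A.
rewrite /oriented_orthonormal det_mulmx det_tr dA mul1r dB andbT.
by rewrite trmx_mul trmxK -!mulmxA (mulmxA B) (mulmxA (B *m _)) BB mul1mx (mulmx1C AA).
Qed.

(* (u_j)_j . A = (\sum_i A_ij u_i)_j *)
Definition frame_act (f : SO_frame) (A : SO R n) : SO_frame :=
  SOFrame (frame_act_subproof f A).

Lemma frame_actM f A B : frame_act f (A * B)%g = frame_act (frame_act f A) B.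
Proof. by apply: SO_frame_eq => //=; rewrite trmx_mul mulmxA. Qed.

Definition frame_coord (c : chart R n M) (f : SO_frame) : 'M[R]_n :=
  frame_mx f *m tangent_change (chart_at (frame_pt f)) c (frame_pt f).

(* Continuity for the topology of P_SO M given by the charts
   f |-> (frame_pt f, frame_coord c f) *)
Definition frame_continuous (T : topologicalType) (F : T -> SO_frame) :=
  continuous (frame_pt \o F) /\
  forall c q, atlas c -> chart_dom c (frame_pt (F q)) ->
    {for q, continuous (frame_coord c \o F)}.

End FrameBundle.

Record principal_bundle (R : realType) (k n : nat) (G : lieGroupType R k)
    (M : manifoldType R n) := PrincipalBundle {
  bundle_total :> manifoldType R (n + k);
  bundle_proj : bundle_total -> M;
  bundle_act : bundle_total -> G -> bundle_total;
  bundle_proj_smooth : smooth_map_on [set: bundle_total] bundle_proj;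
  bundle_act_smooth : smooth_map2 bundle_act;
  bundle_act1 : forall u, bundle_act u 1%g = u;
  bundle_actM : forall u a b,
    bundle_act u (a * b)%g = bundle_act (bundle_act u a) b;
  bundle_proj_act : forall u a, bundle_proj (bundle_act u a) = bundle_proj u;
  (* u |-> (bundle_proj u, h u) is an equivariant diffeomorphism from the part
     over U to U x G, with inverse (x, a) |-> bundle_act (s x) a. *)
  bundle_trivial : forall x, exists U (s : M -> bundle_total)
    (h : bundle_total -> G),
    [/\ open U, U x, smooth_map_on U s, smooth_map_on (bundle_proj @^-1` U) h &
    [/\ forall y, U y -> bundle_proj (s y) = y,
        forall u a, U (bundle_proj u) -> h (bundle_act u a) = (h u * a)%g &
        forall u, U (bundle_proj u) ->
          u = bundle_act (s (bundle_proj u)) (h u)]] }.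

(* P is a manifold on its own, as it need not be embedded when G is not closed;
   that Gstr_incl is an immersion follows from the same property of i. *)
Record G_structure (R : realType) (k n : nat) (G : lieGroupType R k)
    (M : manifoldType R n) (i : lie_subgroup n G) (g : riemannian_metric M)
    (o : orientation M) := GStructure {
  Gstr_bundle :> principal_bundle G M;
  Gstr_incl : Gstr_bundle -> SO_frame g o;
  Gstr_incl_inj : injective Gstr_incl;
  Gstr_incl_pt : forall u, frame_pt (Gstr_incl u) = bundle_proj u;
  Gstr_incl_act : forall u a,
    Gstr_incl (bundle_act u a) = frame_act (Gstr_incl u) (i a);
  Gstr_incl_smooth : forall c, atlas c ->
    smooth_fun_on (@bundle_proj _ _ _ _ _ Gstr_bundle @^-1` chart_dom c)
      (frame_coord c \o Gstr_incl) }.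

(* The projection is then automatically a 2-fold covering: over U it is
   (x, a) |-> (s' x) . (spin_cover a), with s' = spin_proj \o s a continuous
   section of P_SO M, and spin_cover is a 2-fold covering. *)
Record spin_structure (R : realType) (n : nat) (M : manifoldType R n)
    (g : riemannian_metric M) (o : orientation M) := SpinStructure {
  spin_total :> topologicalType;
  spin_act : spin_total -> Spin R n -> spin_total;
  spin_proj : spin_total -> SO_frame g o;
  spin_act_cont :
    continuous (fun p : spin_total * Spin R n => spin_act p.1 p.2);
  spin_act1 : forall q, spin_act q 1%g = q;
  spin_actM : forall q a b, spin_act q (a * b)%g = spin_act (spin_act q a) b;
  spin_proj_cont : frame_continuous spin_proj;
  spin_proj_act : forall q a,
    spin_proj (spin_act q a) = frame_act (spin_proj q) (spin_cover a);
  spin_trivial : forall x, exists U (s : M -> spin_total)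
    (h : spin_total -> Spin R n),
    [/\ open U, U x, forall y, U y -> {for y, continuous s},
        forall q, U (frame_pt (spin_proj q)) -> {for q, continuous h} &
    [/\ forall y, U y -> frame_pt (spin_proj (s y)) = y,
        forall q a, U (frame_pt (spin_proj q)) -> h (spin_act q a) = (h q * a)%g &
        forall q, U (frame_pt (spin_proj q)) ->
          q = spin_act (s (frame_pt (spin_proj q))) (h q)]] }.

(* Such a homeomorphism is automatically a diffeomorphism, the projections being
   coverings of P_SO M. *)
Definition spin_equivalent (R : realType) (n : nat) (M : manifoldType R n)
    (g : riemannian_metric M) (o : orientation M) (Q Q' : spin_structure g o) :=
  exists (F : Q -> Q') (F' : Q' -> Q),
    [/\ cancel F F', cancel F' F, continuous F & continuous F'] /\
    [/\ forall q a, F (spin_act q a) = spin_act (F q) a &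
        forall q, spin_proj (F q) = spin_proj q].

Section Continuity.
Context {R : realType}.

Lemma eq_cont (T T' : topologicalType) (f h : T -> T') (x : T) :
  f =1 h -> {for x, continuous h} -> {for x, continuous f}.
Proof. by move=> /funext ->. Qed.

Lemma eq_near_cont (T T' : topologicalType) (f h : T -> T') (x : T) :
  (\forall y \near x, f y = h y) -> {for x, continuous h} ->
  {for x, continuous f}.
Proof.
move=> fh hc A; rewrite (nbhs_singleton fh) => /hc.
by apply: filterS2 fh => y /= ->.
Qed.

Lemma cont_pair (T X Y : topologicalType) (f : T -> X) (h : T -> Y) (x : T) :
  {for x, continuous f} -> {for x, continuous h} ->
  {for x, continuous (fun t => (f t, h t))}.
Proof. by move=> fc hc; exact: cvg_pair. Qed.

Lemma cont_comp (T X Y : topologicalType) (f : T -> X) (h : X -> Y) (x : T) :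
  {for x, continuous f} -> {for f x, continuous h} ->
  {for x, continuous (fun t => h (f t))}.
Proof. exact: continuous_comp. Qed.

Lemma cont_mx (T : topologicalType) m n (f : T -> 'M[R]_(m, n)) (x : T) :
  (forall i j, {for x, continuous (fun t => f t i j)}) -> {for x, continuous f}.
Proof.
move=> fc A [P PA sA]; rewrite /= /nbhs /=.
have : \forall t \near x, forall i j, P i j (f t i j).
  apply: filter_forall => i; apply: filter_forall => j; exact: fc (PA i j).
by apply: filterS => t; exact: sA.
Qed.

Lemma cont_sum (T : topologicalType) (I : finType) (f : I -> T -> R) (x : T) :
  (forall i, {for x, continuous (f i)}) ->
  {for x, continuous (fun t => \sum_i f i t)}.
Proof.
move=> fc; elim: (index_enum I) => [|i r IH].
  by apply: (eq_cont (h := fun=> 0)) => [t|]; [rewrite big_nil | exact: cst_continuous].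
apply: (eq_cont (h := fun t => f i t + \sum_(j <- r) f j t)) => [t|].
  by rewrite big_cons.
by apply: continuousD; [exact: fc | exact: IH].
Qed.

Lemma cont_entry (T : topologicalType) m n (f : T -> 'M[R]_(m, n)) (x : T) i j :
  {for x, continuous f} -> {for x, continuous (fun t => f t i j)}.
Proof.
move=> fc; apply: (@continuous_comp _ _ _ f (fun A : 'M[R]_(m, n) => A i j)) => //.
exact: coord_continuous.
Qed.

Lemma cont_mulmx (T : topologicalType) m n p (f : T -> 'M[R]_(m, n))
    (h : T -> 'M[R]_(n, p)) (x : T) :
  {for x, continuous f} -> {for x, continuous h} ->
  {for x, continuous (fun t => f t *m h t)}.
Proof.
move=> fc hc; apply: cont_mx => i j.
apply: (eq_cont (h := fun t => \sum_k f t i k * h t k j)) => [t|].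
  by rewrite mxE.
apply: cont_sum => k; apply: continuousM; exact: cont_entry.
Qed.

Lemma cont_ccoef (T : topologicalType) n (f : T -> Spin R n) (x : T) A :
  {for x, continuous f} -> {for x, continuous (fun t => ccoef (f t) A)}.
Proof.
move=> fc; apply: (@cont_entry T 1 _ (@spin_cliff R n \o f : T -> 'rV[R]_#|{set 'I_n}|)).
apply: (@continuous_comp T (Spin R n)) => //; exact: initial_continuous.
Qed.

Lemma cont_ccoef_mul (T : topologicalType) n (f h : T -> cliff R n) (x : T) :
  (forall A, {for x, continuous (fun t => ccoef (f t) A)}) ->
  (forall A, {for x, continuous (fun t => ccoef (h t) A)}) ->
  forall A, {for x, continuous (fun t => ccoef (cmul (f t) (h t)) A)}.
Proof.
move=> fc hc A; apply: (eq_cont (fun t => cbuildE _ A)).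
apply: cont_sum => B; apply: continuousM; last exact: hc.
by apply: (@continuousM R T (fun=> csign B _) (fun t => ccoef (f t) B)); [exact: cvg_cst | exact: fc].
Qed.

Lemma cont_spin (T : topologicalType) n (f : T -> Spin R n) (x : T) :
  (forall A, {for x, continuous (fun t => ccoef (f t) A)}) -> {for x, continuous f}.
Proof.
move=> fc A [B [[W oW <-] /= Wx] WA].
have /(_ W) : {for x, continuous (@spin_cliff R n \o f : T -> 'rV[R]_#|{set 'I_n}|)}.
  apply: cont_mx => i j; refine (@eq_cont T R _ _ x _ (fc (enum_val j))) => t.
  by rewrite /ccoef enum_valK ord1.
move=> h; have {h} := h (open_nbhs_nbhs (conj oW Wx)).
by apply: (@filterS _ (nbhs x)) => t; exact: WA.
Qed.

Lemma cont_spin_mul (T : topologicalType) n (f h : T -> Spin R n) (x : T) :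
  {for x, continuous f} -> {for x, continuous h} ->
  {for x, continuous (fun t => (f t * h t)%g)}.
Proof.
move=> fc hc; apply: cont_spin => A.
by apply: cont_ccoef_mul => B; exact: cont_ccoef.
Qed.

Lemma cont_spin_cover (T : topologicalType) n (f : T -> Spin R n) (x : T) :
  {for x, continuous f} ->
  {for x, continuous (fun t => (spin_cover (f t) : 'M[R]_n))}.
Proof.
move=> fc; apply: cont_mx => i j.
apply: (eq_cont (fun t => mxE _ _ _ _)).
apply: cont_ccoef_mul => A.
  apply: cont_ccoef_mul => B; first exact: cont_ccoef.
  exact: cvg_cst.
apply: (eq_cont (fun t => cbuildE _ A)).
apply: (@continuousM R T (fun=> csign A A) (fun t => ccoef (f t) A)).
  exact: cvg_cst.
exact: cont_ccoef.
Qed.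

Lemma smooth_fun_on_cont k (X : manifoldType R k) (V : normedModType R)
    (U : set X) (f : X -> V) (x : X) :
  open U -> U x -> smooth_fun_on U f -> {for x, continuous f}.
Proof.
move=> oU Ux sf; have [c ac cx] := atlas_cover x.
have /(_ 0 (c x)) fc := sf c ac.
have {}fc : {for c x, continuous (f \o chart_inv c)} by apply: fc; exists x.
have h : {for x, continuous ((f \o chart_inv c) \o c)}.
  by apply: continuous_comp fc; exact: chart_map_cont.
move=> A; rewrite -{1}(chart_mapK cx) => /h.
apply: filterS2 (open_nbhs_nbhs (conj (chart_dom_open c) cx)) => y cy.
by rewrite /= chart_mapK.
Qed.

End Continuity.

Section Enlargement.
Context {R : realType} {k n : nat} {G : lieGroupType R k} {M : manifoldType R n}
  {i : lie_subgroup n G} {g : riemannian_metric M} {o : orientation M}.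
Variables (P : G_structure i g o) (phi : spin_lift i).

(* (u a, b) ~ (u, phi a * b) *)
Definition enl_rel (p q : P * Spin R n) : bool :=
  `[< exists a : G, q.1 = bundle_act p.1 a /\ p.2 = (phi a * q.2)%g >].

Lemma lift1 : phi 1%g = 1%g.
Proof. by apply: (mulgI (phi 1%g)); rewrite -liftM !mulg1. Qed.

Lemma liftV a : phi a^-1%g = (phi a)^-1%g.
Proof. by apply: (mulgI (phi a)); rewrite -liftM !mulgV lift1. Qed.

Lemma enl_refl : reflexive enl_rel.
Proof. by move=> p; apply/asboolP; exists 1%g; rewrite bundle_act1 lift1 mul1g. Qed.

Lemma enl_sub p q : enl_rel p q -> enl_rel q p.
Proof.
move=> /asboolP[a [e1 e2]]; apply/asboolP; exists a^-1%g.
by rewrite e1 e2 -bundle_actM mulgV bundle_act1 liftV mulKg.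
Qed.

Lemma enl_sym : symmetric enl_rel.
Proof. by move=> p q; apply/idP/idP; exact: enl_sub. Qed.

Lemma enl_trans : transitive enl_rel.
Proof.
move=> q p r /asboolP[a [a1 a2]] /asboolP[b [b1 b2]]; apply/asboolP.
by exists (a * b)%g; rewrite b1 a1 a2 b2 bundle_actM liftM mulgA.
Qed.

Canonical enl_equiv := EquivRel enl_rel enl_refl enl_sym enl_trans.

(* P x_phi Spin_n, with the quotient topology *)
Definition enl_total := quotient_topology {eq_quot enl_equiv}%qT.

HB.instance Definition _ := Topological.on enl_total.

Definition enl_class (p : P * Spin R n) : enl_total := (\pi_enl_total p)%qT.

Definition enl_act (q : enl_total) (b : Spin R n) : enl_total :=
  enl_class ((repr q).1, ((repr q).2 * b)%g).

Definition enl_proj (q : enl_total) : SO_frame g o :=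
  frame_act (Gstr_incl (repr q).1) (spin_cover (repr q).2).


Lemma enl_classP p q : enl_class p = enl_class q <-> enl_rel p q.
Proof.
have eP : reflect (enl_class p = enl_class q) (enl_rel p q).
  exact: (@eqmodP _ enl_equiv p q).
by split => [h|h]; apply/eP.
Qed.

Lemma enl_repr p : enl_rel (repr (enl_class p)) p.
Proof. by apply/enl_classP; exact: reprK. Qed.

Lemma enl_classK (q : enl_total) : exists p, q = enl_class p.
Proof. by exists (repr q); rewrite /enl_class reprK. Qed.

Lemma enl_class_cont : continuous enl_class.
Proof. exact: pi_continuous. Qed.

Lemma enl_actE u a b : enl_act (enl_class (u, a)) b = enl_class (u, (a * b)%g).
Proof.
apply/enl_classP; have /asboolP[c] := enl_repr (u, a).
move: (repr _) => [v b'] /= [-> ->].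
by apply/asboolP; exists c; rewrite /= mulgA.
Qed.

Lemma enl_projE u a :
  enl_proj (enl_class (u, a)) = frame_act (Gstr_incl u) (spin_cover a).
Proof.
rewrite /enl_proj; have /asboolP[c] := enl_repr (u, a).
move: (repr _) => [v b] /= [-> ->].
by rewrite spin_coverM lift_cover Gstr_incl_act frame_actM.
Qed.

Lemma enl_projE_pt u a : frame_pt (enl_proj (enl_class (u, a))) = bundle_proj u.
Proof. by rewrite enl_projE /= Gstr_incl_pt. Qed.

Lemma enl_cont (Z : topologicalType) (V : set enl_total) (f : enl_total -> Z) :
  open V -> (forall p, V (enl_class p) -> {for p, continuous (f \o enl_class)}) ->
  forall q, V q -> {for q, continuous f}.
Proof.
move=> oV fc q Vq A; rewrite nbhsE => -[B [oB Bfq] BA].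
have : open (V `&` f @^-1` B).
  change (open (enl_class @^-1` (V `&` f @^-1` B))).
  rewrite openE => p [Vp Bp].
  apply: filterI; first exact: (enl_class_cont (open_nbhs_nbhs (conj oV Vp))).
  exact: (fc p Vp B (open_nbhs_nbhs (conj oB Bp))).
move=> oW; have : nbhs q (V `&` f @^-1` B) by apply: open_nbhs_nbhs.
by apply: (@filterS _ (nbhs q)) => y [_ /BA].
Qed.

Lemma enl_pt_cont : continuous (fun q => frame_pt (enl_proj q)).
Proof.
move=> q; apply: (enl_cont openT) => // -[u a] _.
apply: (eq_cont (h := fun p : P * Spin R n => bundle_proj p.1)).
  by case=> v b; exact: enl_projE_pt.
apply: cont_comp; first exact: cvg_fst.
by apply: (proj1 (bundle_proj_smooth P)).
Qed.

Lemma lift_cont : continuous phi.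
Proof.
move=> a; apply: cont_spin => A.
have := @smooth_fun_on_cont R k G _ _ _ a openT I (@lift_smooth _ _ _ _ _ phi).
exact: (@cont_entry R G 1).
Qed.

Lemma enl_trivial_aux x : exists U (s : M -> P) (h : enl_total -> Spin R n),
  [/\ open U, U x, forall y, U y -> {for y, continuous s},
      forall q, U (frame_pt (enl_proj q)) -> {for q, continuous h} &
  [/\ forall y, U y -> bundle_proj (s y) = y,
      forall q a, U (frame_pt (enl_proj q)) -> h (enl_act q a) = (h q * a)%g &
      forall q, U (frame_pt (enl_proj q)) ->
        q = enl_class (s (frame_pt (enl_proj q)), h q)]].
Proof.
have [U [s [h [oU Ux [sc _] [hc _] [ps hM sh]]]]] := bundle_trivial P x.
pose H q := (phi (h (repr (q : enl_total)).1) * (repr q).2)%g.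
have HE u a : U (bundle_proj u) -> H (enl_class (u, a)) = (phi (h u) * a)%g.
  move=> Uu; rewrite /H; have /asboolP[c] := enl_repr (u, a).
  move: (repr _) => [v b] /= [e ->]; move: Uu; rewrite e bundle_proj_act => Uv.
  by rewrite hM // liftM mulgA.
exists U, s, H; split=> //.
  apply: enl_cont.
    by have /continuousP := enl_pt_cont; apply.
  move=> [u a]; rewrite /= enl_projE_pt => Uu.
  apply: (eq_near_cont (h := fun p : P * Spin R n => (phi (h p.1) * p.2)%g)).
    have : \forall p \near (u, a), U (bundle_proj p.1).
      apply: (@cont_comp (P * Spin R n)%type P M fst (@bundle_proj _ _ _ _ _ P)).
      - exact: cvg_fst.
      - by apply: (proj1 (bundle_proj_smooth P)).
      - exact: open_nbhs_nbhs.
    by apply: filterS => -[v b] /= Uv; exact: HE.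
  apply: cont_spin_mul; last exact: cvg_snd.
  apply: cont_comp; last exact: lift_cont.
  by apply: cont_comp; [exact: cvg_fst | exact: hc].
split=> //.
- move=> q a; have [[u b] ->] := enl_classK q; rewrite enl_projE_pt => Uu.
  by rewrite enl_actE !HE // mulgA.
- move=> q; have [[u b] ->] := enl_classK q; rewrite enl_projE_pt => Uu.
  rewrite HE //; apply/esym/enl_classP/asboolP.
  by exists (h u); rewrite /= -sh.
Qed.

Lemma enl_trivial x : exists U (s : M -> enl_total) (h : enl_total -> Spin R n),
  [/\ open U, U x, forall y, U y -> {for y, continuous s},
      forall q, U (frame_pt (enl_proj q)) -> {for q, continuous h} &
  [/\ forall y, U y -> frame_pt (enl_proj (s y)) = y,
      forall q a, U (frame_pt (enl_proj q)) -> h (enl_act q a) = (h q * a)%g &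
      forall q, U (frame_pt (enl_proj q)) ->
        q = enl_act (s (frame_pt (enl_proj q))) (h q)]].
Proof.
have [U [s [h [oU Ux sc hc [ps hM sh]]]]] := enl_trivial_aux x.
exists U, (fun y => enl_class (s y, 1%g)), h; split=> //.
  move=> y Uy; apply: cont_comp; last exact: enl_class_cont.
  by apply: cont_pair; [exact: sc | exact: cvg_cst].
split=> // [y Uy|q Uq]; first by rewrite enl_projE_pt ps.
by rewrite enl_actE mul1g -sh.
Qed.

Lemma enl_act_cont :
  continuous (fun p : enl_total * Spin R n => enl_act p.1 p.2).
Proof.
move=> [q b]; have [U [s [h [oU Uq sc hc [_ _ sh]]]]] :=
  enl_trivial_aux (frame_pt (enl_proj q)).
have pt_cont : {for (q, b), continuous
    (fun p : enl_total * Spin R n => frame_pt (enl_proj p.1))}.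
  apply: (@cont_comp (enl_total * Spin R n)%type enl_total M fst
    (fun q => frame_pt (enl_proj q))); [exact: cvg_fst | exact: enl_pt_cont].
apply: (eq_near_cont (h := fun p : enl_total * Spin R n =>
  enl_class (s (frame_pt (enl_proj p.1)), (h p.1 * p.2)%g))).
  have : \forall p \near (q, b), U (frame_pt (enl_proj p.1)).
    by apply: pt_cont; exact: open_nbhs_nbhs.
  by apply: filterS => -[q' a] /= /sh e; rewrite [in LHS]e enl_actE.
apply: cont_comp; last exact: enl_class_cont.
apply: cont_pair.
  exact: (@cont_comp (enl_total * Spin R n)%type M P _ s _ pt_cont (sc _ Uq)).
apply: cont_spin_mul; last exact: cvg_snd.
by apply: cont_comp; [exact: cvg_fst | exact: hc].
Qed.

Lemma enl_act1 q : enl_act q 1%g = q.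
Proof. by have [[u c] ->] := enl_classK q; rewrite enl_actE mulg1. Qed.

Lemma enl_actM q a b : enl_act q (a * b)%g = enl_act (enl_act q a) b.
Proof. by have [[u c] ->] := enl_classK q; rewrite !enl_actE mulgA. Qed.

Lemma enl_proj_act q a :
  enl_proj (enl_act q a) = frame_act (enl_proj q) (spin_cover a).
Proof.
have [[u c] ->] := enl_classK q.
by rewrite enl_actE !enl_projE spin_coverM frame_actM.
Qed.

Lemma enl_proj_cont : frame_continuous enl_proj.
Proof.
split; first exact: enl_pt_cont.
move=> c q ac cq.
have oV : open [set q | chart_dom c (frame_pt (enl_proj q))].
  by have /continuousP := enl_pt_cont; apply; exact: chart_dom_open.
refine (@enl_cont _ _ (frame_coord c \o enl_proj) oV _ q cq).
move=> -[u a]; rewrite /mkset enl_projE_pt => cu.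
apply: (eq_cont (h := fun p : P * Spin R n =>
  (spin_cover p.2 : 'M[R]_n)^T *m frame_coord c (Gstr_incl p.1))).
  by case=> v b; rewrite /= enl_projE /frame_coord /= mulmxA.
apply: cont_mulmx.
  apply: cont_mx => j l.
  apply: (eq_cont (h := fun p : P * Spin R n => (spin_cover p.2 : 'M[R]_n) l j)).
    by move=> p; rewrite mxE.
  by apply: cont_entry; apply: cont_spin_cover; exact: cvg_snd.
apply: (@cont_comp _ P _ fst (frame_coord c \o @Gstr_incl _ _ _ _ _ _ _ _ P)).
  exact: cvg_fst.
have sP := @Gstr_incl_smooth _ _ _ _ _ _ _ _ P c ac.
refine (@smooth_fun_on_cont R _ P _ _ _ u _ cu sP).
have /continuousP : continuous (@bundle_proj _ _ _ _ _ P).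
  by move=> v; apply: (proj1 (bundle_proj_smooth P)).
by apply; exact: chart_dom_open.
Qed.

Definition enlargement : spin_structure g o :=
  SpinStructure enl_act_cont enl_act1 enl_actM enl_proj_cont enl_proj_act
    enl_trivial.

End Enlargement.

(* Main.v *)
Require Import Defs.
From mathcomp Require Import all_boot all_order all_algebra.
From mathcomp Require Import all_classical all_reals.
From mathcomp Require Import topology normedtype derive.

(* Two lifts of a map X -> P_SO M to a spin structure differ by a continuous map
   X -> ker (Spin_n -> SO_n) = {1, -1}, which is constant when X is connected.
   For an equivalence F, apply this on P to u |-> F [u, 1] and u |-> [u, 1]:
   they differ by a constant central element e, and comparing at u and at u a
   yields e phi2(a) = phi1(a) e. *)

Import Order.TTheory GRing.Theory Num.Theory.
Import numFieldNormedType.Exports.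

Local Open Scope classical_set_scope.
Local Open Scope ring_scope.

(** Multiplication by a basis vector permutes the basis up to sign, so a single term of the
    convolution survives. *)
Lemma ccoef_cmul_basel (R : realType) (n : nat) (A B : {set 'I_n}) (x : cliff R n) :
  ccoef (cmul (cbase A) x) (symdiff A B) = csign A B * ccoef x B.
Proof.
rewrite cbuildE (bigD1 A) //= big1 => [|C nC]; last first.
  by rewrite cbuildE (negPf nC) mulr0 mul0r.
by rewrite cbuildE eqxx symdiffK mulr1 addr0.
Qed.

Lemma ccoef_cmul_baser (R : realType) (n : nat) (A B : {set 'I_n}) (x : cliff R n) :
  ccoef (cmul x (cbase A)) (symdiff A B) = csign B A * ccoef x B.
Proof.
rewrite cbuildE (bigD1 B) //= big1 => [|C nC]; last first.
  rewrite [ccoef (cbase _) _]cbuildE; case: eqP => [e|_]; last by rewrite mulr0.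
  case/eqP: nC; have := symdiffK (symdiff A B) C.
  by rewrite [symdiff _ C]symdiffC e symdiffC symdiffK => ->.
have -> : symdiff B (symdiff A B) = A by rewrite [symdiff A B]symdiffC symdiffK.
by rewrite cbuildE eqxx mulr1 addr0.
Qed.

(** Moving [e_j] through [e_A] crosses the factor [e_j] itself, with which it commutes, and the
    [#|A| - 1] others, with which it anticommutes. That number is odd. *)
Lemma csign_anticomm (R : realType) (n : nat) (A : {set 'I_n}) (j : 'I_n) :
  j \in A -> ~~ odd #|A| -> csign A [set j]%SET = - csign [set j]%SET A :> R.
Proof.
move=> jA eA; rewrite -[RHS]mulr1 -(csign2 [set j]%SET A : _ = 1 :> R).
suff h : csign A [set j]%SET * csign [set j]%SET A = -1 :> R.
  by rewrite mulrA mulNr csign2 mulN1r -[LHS]mulr1 -(csign2 [set j]%SET A) mulrA h mulN1r.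
rewrite {1}/csign; under eq_bigr => i _ do rewrite big_set1.
(* The index [j] contributes [(-1) * (-1)]; any other [i] contributes one factor -1, as exactly one
   of [i < j], [j < i] holds. *)
rewrite /csign big_set1 -big_split /= (bigD1 j) //= leqnn mulrNN mulr1 mul1r.
rewrite (eq_bigr (fun=> -1)) => [|i /andP[_ ij]]; last first.
  have : (i != j :> nat) by [].
  by case: ltngtP => // _ _; rewrite ?mulr1 ?mul1r.
rewrite prodr_const -signr_odd; suff -> : odd #|[pred i | (i \in A) && (i != j)]| by [].
move: eA; rewrite (cardsD1 j) jA add1n /= negbK.
by congr (odd _); apply: eq_card => i; rewrite !inE andbC.
Qed.

(** An element over the identity commutes with every [e_j]. This kills its coefficients on nonempty
    even sets, and evenness kills the odd ones, so it is a scalar, whose square is 1 because [x]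
    times its conjugate is 1. *)
Lemma spin_cover_ker (R : realType) (n : nat) (x : Spin R n) :
  spin_cover x = 1%g ->
  exists2 c : R, c ^+ 2 = 1 & x = c *: cbase finset.set0 :> cliff R n.
Proof.
move=> /(congr1 (@SO_mx R n)) /= x1.
have [ex xx' x'x xe _] := spinE (spin_cliffP x).
have xj j : cmul (cvec R j) x = cmul x (cvec R j).
  rewrite -[RHS]cmulx1 -x'x cmulA xe x1; congr (cmul _ _).
  rewrite (bigD1 j) //= big1 ?addr0 => [|i ij]; first by rewrite mxE eqxx scale1r.
  by rewrite mxE (negPf ij) scale0r.
have xs : x = ccoef x finset.set0 *: cbase finset.set0 :> cliff R n.
  apply: cliffP => A; rewrite ccoefZ cbuildE.
  have [->|/set0Pn[j jA]] := eqVneq A finset.set0; first by rewrite mulr1.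
  rewrite mulr0; have [oA|eA] := boolP (odd #|A|).
    by apply/eqP; move/forallP/(_ A)/implyP: ex; exact.
  (* Anticommutation makes the two coefficients opposite, so twice [ccoef x A], up to sign, is 0. *)
  have := congr1 (fun y => ccoef y (symdiff [set j]%SET A)) (xj j).
  rewrite ccoef_cmul_basel ccoef_cmul_baser csign_anticomm // mulNr.
  move=> /eqP; rewrite -addr_eq0 -mulr2n mulrn_eq0 /= mulf_eq0 => /orP[|/eqP //].
  have := csign2 [set j]%SET A : _ = 1 :> R.
  by move=> + /eqP h; rewrite h mul0r => /eqP; rewrite eq_sym oner_eq0.
exists (ccoef x finset.set0) => //.
have cc : cconj x = x :> cliff R n.
  rewrite xs; apply: cliffP => A; rewrite !cbuildE !ccoefZ cbuildE.
  by case: eqVneq => [->|_]; rewrite ?mulr0 // csign0l mul1r.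
have := congr1 (fun y => ccoef y finset.set0) xx'.
rewrite cc {1 2}xs cmulZl cmulZr cmul1x !ccoefZ cbuildE eqxx mulr1.
by rewrite expr2.
Qed.

Lemma cont_spin_inv (R : realType) (T : topologicalType) (n : nat)
    (f : T -> Spin R n) (x : T) :
  {for x, continuous f} -> {for x, continuous (fun t => (f t)^-1%g)}.
Proof.
move=> fc; apply: cont_spin => A.
apply: (eq_cont (fun t => cbuildE _ A)).
apply: (@continuousM R T (fun=> csign A A) (fun t => ccoef (f t) A)).
  exact: cvg_cst.
exact: cont_ccoef.
Qed.

Section SpinStructure.
Context {R : realType} {n : nat} {M : manifoldType R n}
  {g : riemannian_metric M} {o : orientation M}.

(** A frame matrix [B] has the right inverse [g p *m B^T] by orthonormality, so it cancels. *)
Lemma frame_act_inj (f : SO_frame g o) (A : SO R n) : frame_act f A = f -> A = 1%g.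
Proof.
move=> /(congr1 (@frame_mx _ _ _ _ _)) /= e.
have /andP[/eqP BB _] := frame_mxP f.
apply/val_inj/trmx_inj; rewrite /= trmx1.
by rewrite -[LHS]mulmx1 -{1}BB !mulmxA e BB.
Qed.

Context {Q : spin_structure g o}.

(** The local coordinate [h] is equivariant, and translation in the group is injective. *)
Lemma spin_act_inj (q : Q) : injective (spin_act q).
Proof.
move=> a b e; have [U [s [h [_ Uq _ _ [_ hM _]]]]] :=
  spin_trivial Q (frame_pt (spin_proj q)).
by apply: (mulgI (h q)); rewrite -!hM // e.
Qed.

(** In a trivialisation both points lie over the same value of [s], so [a] is the quotient of their
    coordinates. Its image fixes the common frame, on which [SO R n] acts freely. *)
Lemma spin_fiber (q q' : Q) : spin_proj q = spin_proj q' ->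
  exists2 a, spin_cover a = 1%g & q' = spin_act q a.
Proof.
move=> e; have [U [s [h [_ Uq _ _ [_ _ sh]]]]] :=
  spin_trivial Q (frame_pt (spin_proj q)).
have e' : q' = spin_act q ((h q)^-1 * h q')%g.
  have Uq' : U (frame_pt (spin_proj q')) by rewrite -e.
  by rewrite [LHS](sh q' Uq') -e [X in _ = spin_act X _](sh q Uq) -spin_actM mulVKg.
exists ((h q)^-1 * h q')%g => //.
by apply: (@frame_act_inj (spin_proj q)); rewrite -spin_proj_act -e'.
Qed.

Lemma spin_lifts_differ_const (X : topologicalType) (f1 f2 : X -> Q) (x0 : X) :
  connected [set: X] -> continuous f1 -> continuous f2 ->
  (forall x, spin_proj (f1 x) = spin_proj (f2 x)) ->
  exists2 a, spin_cover a = 1%g & forall x, f2 x = spin_act (f1 x) a.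
Proof.
move=> cX f1c f2c f12.
have [e eK ef] : exists2 e : X -> Spin R n,
    forall x, spin_cover (e x) = 1%g & forall x, f2 x = spin_act (f1 x) (e x).
  have /choice[e he] x : exists a, spin_cover a = 1%g /\ f2 x = spin_act (f1 x) a.
    by have [a] := spin_fiber _ _ (f12 x); exists a.
  by exists e => x; have [] := he x.
have ec : continuous e.
  move=> x; have [U [s [h [oU Ux _ hc [_ hM _]]]]] :=
    spin_trivial Q (frame_pt (spin_proj (f1 x))).
  have ptc : {for x, continuous (fun y => frame_pt (spin_proj (f1 y)))}.
    apply: (@cont_comp X Q M f1 (fun q => frame_pt (spin_proj q))); first exact: f1c.
    exact: (proj1 (spin_proj_cont Q)).
  (* In a local trivialisation the difference [e] is a quotient of coordinates, hence continuous. *)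
  apply: (eq_near_cont (h := fun y => ((h (f1 y))^-1 * h (f2 y))%g)).
    have : \forall y \near x, U (frame_pt (spin_proj (f1 y))).
      by apply: ptc; exact: open_nbhs_nbhs.
    by apply: filterS => y Uy; rewrite ef hM // mulKg.
  apply: cont_spin_mul.
    apply: cont_spin_inv; apply: cont_comp; [exact: f1c | exact: hc].
  by apply: cont_comp; [exact: f2c | apply: hc; rewrite -f12].
exists (e x0) => // x; rewrite ef; congr spin_act.
(* As [e y] and [e x0] are both 1 or -1, [c y] is 1 if they agree and -1 if not. It never vanishes,
   so [c > 0] and [c >= 0] cut out the same set, which is open, closed and contains [x0]. *)
pose c y := ccoef (e y) finset.set0 * ccoef (e x0) finset.set0.
have cc : continuous c.
  move=> y; apply: (@continuousM R X (fun y => ccoef (e y) finset.set0)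
    (fun=> ccoef (e x0) finset.set0)); last exact: cvg_cst.
  by apply: cont_ccoef; exact: ec.
have coefE y d : e y = d *: cbase finset.set0 :> cliff R n ->
    ccoef (e y) finset.set0 = d.
  by move=> ->; rewrite ccoefZ cbuildE eqxx mulr1.
have cE y : [/\ 0 < c y -> e y = e x0, e y = e x0 -> 0 < c y & 0 <= c y -> 0 < c y].
  have [d d2 ed] := spin_cover_ker _ _ _ (eK y).
  have [d' d'2 ed'] := spin_cover_ker _ _ _ (eK x0).
  rewrite /c (coefE _ _ ed) (coefE _ _ ed').
  have nz : d * d' != 0.
    have : (d * d') ^+ 2 != 0 by rewrite exprMn d2 d'2 mulr1 oner_eq0.
    by rewrite expf_eq0.
  split=> [dd'|/(congr1 (@spin_cliff R n))|]; last by rewrite le_eqVlt eq_sym (negPf nz).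
    apply/val_inj; rewrite /= ed ed'; congr (_ *: _).
    have /eqP := d2; rewrite -d'2 eqf_sqr => /orP[/eqP //|/eqP dE].
    by move: dd'; rewrite dE mulNr -expr2 d'2 ltr0N1.
  move=> h; move: ed; rewrite h => {}h.
  suff -> : d = d' by rewrite -expr2 d'2 ltr01.
  by have := coefE _ _ h; rewrite (coefE _ _ ed').
suff : [set y | 0 < c y] = [set: X].
  by move=> /seteqP[_ /(_ x I)] /=; case: (cE x).
apply: cX.
- by exists x0 => /=; case: (cE x0) => _ + _; exact.
- exists [set y | 0 < c y]; last by rewrite setTI.
  exact: (proj1 (continuousP c) cc _ (@open_gt R 0)).
- exists [set y | 0 <= c y]; first by apply: preimage_closed (@closed_ge R 0) => y _; exact: cc.
  rewrite setTI; apply/seteqP; split=> y /=; first exact: ltW.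
  by case: (cE y).
Qed.

End SpinStructure.

Theorem theorem4p3 (R : realType) (n k : nat) (M : manifoldType R n)
    (g : riemannian_metric M) (o : orientation M)
    (G : lieGroupType R k) (i : lie_subgroup n G) (P : G_structure i g o)
    (phi1 phi2 : spin_lift i) :
  [set: P] !=set0 -> connected [set: P] ->
  ~ (phi1 =1 phi2) ->
  ~ spin_equivalent (enlargement P phi1) (enlargement P phi2).
Proof.
(* [connected] also holds of the empty set; the point [u] excludes that case and serves as base
   point. *)
move=> [u _] cP ne [F [F' [[_ _ Fc _] [FM Fp]]]]; apply: ne => a.
have one_cont (phi : spin_lift i) :
    continuous (fun v : P => enl_class phi (v, 1%g)).
  move=> v; apply: (@cont_comp P (P * Spin R n)%type _ (fun v => (v, 1%g))
    (enl_class phi)); last exact: enl_class_cont.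
  by apply: cont_pair; [exact: cvg_id | exact: cvg_cst].
(* This is [[u a, 1] = [u, phi a] = [u, 1] . phi a]. *)
have actE (phi : spin_lift i) : enl_class phi (bundle_act u a, 1%g) =
    spin_act (s := enlargement P phi) (enl_class phi (u, 1%g)) (phi a).
  rewrite /= enl_actE mul1g; apply/esym/enl_classP/asboolP.
  by exists a; rewrite /= mulg1.
have [||v|e eK Fe] := spin_lifts_differ_const (Q := enlargement P phi2) P
  (fun v => F (enl_class phi1 (v, 1%g))) (fun v => enl_class phi2 (v, 1%g)) u cP.
- move=> v; apply: (@cont_comp P (enlargement P phi1) (enlargement P phi2)
    (fun v => enl_class phi1 (v, 1%g)) F); [exact: one_cont | exact: Fc].
- exact: one_cont.
- by rewrite Fp /= !enl_projE.
have := Fe (bundle_act u a); rewrite !actE.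
rewrite FM Fe -!spin_actM => /spin_act_inj /(congr1 (@spin_cliff R n)) /=.
(* Being a scalar [c], [e] can be pulled out of both products; a further factor [c] cancels it since
   [c ^+ 2 = 1]. *)
have [c c2 ->] := spin_cover_ker _ _ _ eK.
rewrite cmulZl cmulZr cmul1x cmulx1 => /(congr1 ( *:%R c)).
by rewrite !scalerA -expr2 c2 !scale1r => /val_inj ->.
Qed.
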